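(* The set $\left\{\left(\frac12,\frac{7}{6\sqrt3}\right),\left(\frac12,\frac{1}{6\sqrt3}\right)\right\}$ is an optimal set of two-means for $P$, and the corresponding quantization error is $V_2=V_2(P)=\frac{5}{54}$.
   Context: Let $S_1,S_2,S_3:\mathbb{R}^2\to\mathbb{R}^2$ be $S_1(x_1,x_2)=\frac13(x_1,x_2)$, $S_2(x_1,x_2)=\frac13(x_1,x_2)+\frac23(1,0)$, $S_3(x_1,x_2)=\frac13(x_1,x_2)+\frac23(\frac12,\frac{\sqrt3}{2})$. Let $P$ be the unique Borel probability measure on $\mathbb{R}^2$ with $P=\frac13\sum_{j=1}^3 P\circ S_j^{-1}$; its support is the limit set of $\{S_1,S_2,S_3\}$ (the stretched Sierpiński triangle). For $n\in\mathbb{N}$ the $n$th quantization error of $P$ is $V_n=V_n(P)=\inf\left\{\int\min_{a\in\alpha}\|x-a\|^2\,dP(x):\alpha\subset\mathbb{R}^2,\ \alpha\neq\emptyset,\ \mathrm{card}(\alpha)\le n\right\}$, with $\|\cdot\|$ the Euclidean norm. A set $\alpha$ with at most $n$ elements attaining the infimum is called an optimal set of $n$-means for $P$. *)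

(* Defs.v *)
From mathcomp Require Export all_boot all_order all_algebra finmap.
From mathcomp Require Export all_classical all_reals all_analysis.

Set Implicit Arguments.
Unset Strict Implicit.
Unset Printing Implicit Defensive.

Export Order.TTheory GRing.Theory Num.Theory.
Export numFieldNormedType.Exports.

Local Open Scope classical_set_scope.
Local Open Scope ring_scope.

(* The plane is [R * R]; its product sigma-algebra is the Borel
   sigma-algebra.  The library norm on [R * R] is the sup norm, hence the
   explicit Euclidean norm below. *)
Definition enorm (R : realType) (x : R * R) : R :=
  Num.sqrt (x.1 ^+ 2 + x.2 ^+ 2).

Definition S1 (R : realType) (x : R * R) : R * R :=
  (3^-1 : R) *: x.

Definition S2 (R : realType) (x : R * R) : R * R :=
  (3^-1 : R) *: x + (2 / 3 : R) *: ((1, 0) : R * R).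

Definition S3 (R : realType) (x : R * R) : R * R :=
  (3^-1 : R) *: x + (2 / 3 : R) *: ((1 / 2, Num.sqrt 3 / 2) : R * R).

Definition self_similar (R : realType) (P : probability (R * R)%type R) : Prop :=
  forall A : set (R * R), measurable A ->
    P A = ((3^-1)%:E * (P (@S1 R @^-1` A) + P (@S2 R @^-1` A)
                        + P (@S3 R @^-1` A)))%E.

(* The iterated minimum has neutral element +oo, which is absorbed as soon
   as [alpha] is nonempty. *)
Definition distortion (R : realType) (P : probability (R * R)%type R)
    (alpha : {fset (R * R)}) : \bar R :=
  (\int[P]_x \big[Order.min/+oo]_(a <- alpha) ((enorm (x - a) ^+ 2)%:E))%E.

Definition quantization_error (R : realType) (P : probability (R * R)%type R)
    (n : nat) : \bar R :=
  ereal_inf [set distortion P alpha | alpha in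
    [set alpha : {fset (R * R)} | alpha != fset0 /\ (#|` alpha| <= n)%N]].

Definition optimal_n_means (R : realType) (P : probability (R * R)%type R)
    (n : nat) (alpha : {fset (R * R)}) : Prop :=
  [/\ alpha != fset0, (#|` alpha| <= n)%N
    & distortion P alpha = quantization_error P n].

(* Main.v *)
Require Import Defs.
From mathcomp Require Import measurable_realfun ring lra.
Local Open Scope ring_scope.

(** Write [c] for the centroid of the triangle with vertices [v_i] and [E] for
    the expectation under [P].  One step of self-similarity gives
    [E |x - c|^2 = 1/6] (lemma [variance]), and evaluating the proposed pair
    cell by cell gives a cost of at most [5/54 = 1/6 - 2/27] (lemma
    [mean_min_le]).

    For the lower bound, let [a] and [b] be any two points, [f] the indicator of
    the half-plane of points closer to [a], [p = E f], [d = a - b] and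
    [L x = d . (x - c)].  Expanding the squares,
      [E min(|x-a|^2, |x-b|^2)
         = 1/6 + p |a-c|^2 + (1-p) |b-c|^2 - 2 E(f L)
        >= 1/6 + p (1-p) |d|^2 - 2 E(f L)],
    so it suffices that [2 E(f L) <= 2/27 + p (1-p) |d|^2] for every half-plane
    (lemma [mean_halfplane_le]).

    Let [t_i = L v_i], so that the [t_i] sum to zero and
    [|d|^2 = 2 (t_1^2 + t_2^2 + t_3^2)], and number the vertices so that
    [t_1 <= t_2 <= t_3].  A half-plane [{L >= theta}] that meets the lowest of
    the three cells of the triangle contains the highest one.  Exchanging the
    two half-planes if need be, it therefore misses the lowest cell.  If [p_i] is
    the mass of [f] in the cell [i] and [E_i = E((f o S_i) L)], one step of
    self-similarity reads
      [9 E(f L) = 2 (p_2 t_2 + p_3 t_3) + E_2 + E_3].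
    Each [E_i] is at most [p_i t_3], at most [(1 - p_i)(t_2 + t_3)], and at most
    the constant [(3 t_3 + 2 t_2)/9], the last one by a second step of
    self-similarity.  Using the first bound for [p_i <= 1/3], the third for
    [1/3 <= p_i <= 2/3] and the second for [p_i >= 2/3] leaves a linear form
    [alpha t_2 + beta t_3] to be compared with
    [1/3 + 2 s (3 - s) (t_2^2 + t_2 t_3 + t_3^2)], where [s = p_2 + p_3].  By
    [linear_le_quadratic] this follows from
    [alpha^2 - alpha beta + beta^2 <= 2 s (3 - s)]; on each of the nine
    rectangles for [(p_2, p_3)] the left side is convex and the right side
    concave, so only the corners matter (lemma [cell_bound_quadratic]).

    All expectations are integrals over the triangle, which carries the whole
    mass of [P] (lemma [negligible_outside_triangle]) and on which the functions
    at hand are bounded. *)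

Set Implicit Arguments.
Unset Strict Implicit.
Unset Printing Implicit Defensive.
Local Open Scope classical_set_scope.

(** * The triangle and its barycentric coordinates *)

Section Geometry.
Variable R : realType.
Implicit Types (x : R * R) (i j : 'I_3) (t : 'I_3 -> R).

Definition vertex i : R * R :=
  match val i with
  | 0 => (0, 0)
  | 1 => (1, 0)
  | _ => (1 / 2, Num.sqrt 3 / 2)
  end.

Definition contraction i x : R * R := 3^-1 *: x + (2 / 3 : R) *: vertex i.

Definition bary i x : R :=
  match val i with
  | 0 => 1 - x.1 - x.2 / Num.sqrt 3
  | 1 => x.1 - x.2 / Num.sqrt 3
  | _ => 2 * x.2 / Num.sqrt 3
  end.

Definition triangle : set (R * R) := [set x | forall i, 0 <= bary i x].

Definition centroid : R * R := (1 / 2, Num.sqrt 3 / 6).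

Lemma sqrt3_neq0 : Num.sqrt 3 != 0 :> R.
Proof. by rewrite gt_eqF // sqrtr_gt0; lra. Qed.

Lemma sqr_sqrt3 : Num.sqrt 3 ^+ 2 = 3 :> R.
Proof. by rewrite sqr_sqrtr //; lra. Qed.

Lemma sum_ord3 (F : 'I_3 -> R) :
  \sum_i F i = F 0 + F 1 + F (inord 2).
Proof.
rewrite !big_ord_recl big_ord0 addr0 addrA.
by congr (F _ + F _ + F _); apply: val_inj; rewrite /= ?inordK.
Qed.

Lemma ord3_ind (Q : 'I_3 -> Prop) : Q 0 -> Q 1 -> Q (inord 2) -> forall i, Q i.
Proof.
move=> Q0 Q1 Q2 i.
have : i \in [:: 0; 1; inord 2 : 'I_3].
  by case: i => [[|[|[|]]]] // h; rewrite !inE -!val_eqE /= ?inordK.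
by rewrite !inE => /or3P[] /eqP ->.
Qed.

Lemma vertex2 : vertex (inord 2) = (1 / 2, Num.sqrt 3 / 2).
Proof. by rewrite /vertex [val _]inordK. Qed.

Lemma bary2 x : bary (inord 2) x = 2 * x.2 / Num.sqrt 3.
Proof. by rewrite /bary [val _]inordK. Qed.

Lemma S1E : @S1 R = contraction 0.
Proof.
apply/funext => x; rewrite /S1 /contraction /=.
by rewrite (_ : vertex 0 = 0) // scaler0 addr0.
Qed.

Lemma S2E : @S2 R = contraction 1.
Proof. by []. Qed.

Lemma S3E : @S3 R = contraction (inord 2).
Proof. by apply/funext => x; rewrite /S3 /contraction vertex2. Qed.

(** The reason for barycentric coordinates: in them the three maps differ only by
    the coordinate that receives the translation [2/3]. *)
Lemma bary_contraction i j x :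
  bary j (contraction i x) = bary j x / 3 + 2 / 3 * (i == j)%:R.
Proof.
have s0 := sqrt3_neq0.
rewrite -val_eqE; elim/ord3_ind: i; elim/ord3_ind: j;
  rewrite ?bary2 /contraction ?vertex2 /bary /vertex /= ?inordK //= /GRing.scale /=; by field.
Qed.

Lemma sum_bary x : \sum_i bary i x = 1.
Proof. by have s0 := sqrt3_neq0; rewrite sum_ord3 bary2 /bary /=; field. Qed.

Lemma contraction_triangle i x : triangle x -> triangle (contraction i x).
Proof.
move=> Tx j; rewrite bary_contraction; have := Tx j.
by case: (i == j) => /= ?; lra.
Qed.

(** The affine function on the plane that takes the value [t i] at [vertex i]. *)
Definition affine t x : R := \sum_i t i * bary i x.

Lemma affine_contraction t i x : 
  affine t (contraction i x) = affine t x / 3 + 2 / 3 * t i.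
Proof.
rewrite /affine mulr_suml.
under eq_bigr do rewrite bary_contraction mulrDr mulrA.
rewrite big_split /=; congr (_ + _).
rewrite (bigD1 i) //= eqxx big1 => [|j ji]; first by rewrite addr0 mulr1 mulrC.
by rewrite eq_sym (negPf ji) !mulr0.
Qed.

Lemma affine_ge t m x : triangle x -> (forall i, m <= t i) -> m <= affine t x.
Proof.
move=> Tx mt; rewrite -[m]mulr1 -(sum_bary x) mulr_sumr.
by apply: ler_sum => i _; apply: ler_wpM2r.
Qed.

Lemma affine_opp t x : affine (\- t) x = - affine t x.
Proof. by rewrite /affine -sumrN; apply: eq_bigr => i _; rewrite mulNr. Qed.

Lemma affine_le t m x : triangle x -> (forall i, t i <= m) -> affine t x <= m.
Proof.
move=> Tx mt; rewrite -lerN2 -affine_opp; apply: affine_ge => // i.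
by rewrite lerN2.
Qed.

(** Sorting is expressed by a reindexing of sums, so that later sums over the
    vertices can be expanded in increasing order of [t]. *)
Lemma sort3 t : exists i j k, [/\ t i <= t j, t j <= t k &
  forall F : 'I_3 -> R, \sum_i F i = F i + F j + F k].
Proof.
have [h01|/ltW h10] := leP (t 0) (t 1); have [h12|/ltW h21] := leP (t 1) (t (inord 2));
  have [h02|/ltW h20] := leP (t 0) (t (inord 2)).
- by exists 0, 1, (inord 2); split => // F; rewrite sum_ord3.
- exists 0, 1, (inord 2); split => //  F; rewrite sum_ord3; lra.
- exists 0, (inord 2), 1; split => //  F; rewrite sum_ord3; lra.
- exists (inord 2), 0, 1; split => //  F; rewrite sum_ord3; lra.
- exists 1, 0, (inord 2); split => //  F; rewrite sum_ord3; lra.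
- exists 1, (inord 2), 0; split => //  F; rewrite sum_ord3; lra.
- exists (inord 2), 1, 0; split => //  F; rewrite sum_ord3; lra.
- exists (inord 2), 1, 0; split => //  F; rewrite sum_ord3; lra.
Qed.

Lemma measurable_bary i : measurable_fun setT (bary i).
Proof.
have [a [b [c ->]]] : exists a b c, bary i = fun x => a * x.1 + b * x.2 + c.
  have s0 := sqrt3_neq0.
  elim/ord3_ind: i.
  - exists (-1), (- (Num.sqrt 3)^-1), 1; apply/funext=> x; rewrite /bary /=; by field.
  - exists 1, (- (Num.sqrt 3)^-1), 0; apply/funext=> x; rewrite /bary /=; by field.
  - exists 0, (2 / (Num.sqrt 3)), 0; apply/funext=> x; rewrite bary2 /=; by field.
apply: measurable_funD => //; apply: measurable_funD; apply: measurable_funM => //.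
Qed.

Lemma measurable_contraction i : measurable_fun setT (contraction i).
Proof.
apply/measurable_fun_pairP; split.
  rewrite (_ : _ \o _ = fun x => 3^-1 * x.1 + 2 / 3 * (vertex i).1) //.
  by apply: measurable_funD => //; apply: measurable_funM.
rewrite (_ : _ \o _ = fun x => 3^-1 * x.2 + 2 / 3 * (vertex i).2) //.
by apply: measurable_funD => //; apply: measurable_funM.
Qed.

Lemma measurable_triangle : measurable triangle.
Proof.
rewrite (_ : triangle = \bigcap_(i in [set: 'I_3]) (bary i @^-1` `[0, +oo[)).
  apply: fin_bigcap_measurable => // i _; rewrite -[X in measurable X]setTI.
  by apply: measurable_bary => //.
apply/seteqP; split => x /= h i => [_|]; last by have := h i I; rewrite /= in_itv /= andbT.
by rewrite /= in_itv /= andbT.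
Qed.

End Geometry.
Arguments vertex {R} i.
Arguments triangle {R} _.
Arguments centroid {R}.


(** * The support of a self-similar probability *)

Section Support.
Variables (R : realType) (P : probability (R * R)%type R).
Hypothesis hP : self_similar P.
Implicit Types (x : R * R) (i : 'I_3) (A : set (R * R)).

Lemma self_similarE A : measurable A ->
  P A = ((3^-1)%:E * (P (contraction 0%R @^-1` A) + P (contraction 1%R @^-1` A)
                      + P (contraction (inord 2) @^-1` A)))%E.
Proof. by move=> mA; rewrite hP // S1E S2E S3E. Qed.

Lemma measurable_preimage_contraction i A : measurable A ->
  measurable (contraction i @^-1` A).
Proof.
by move=> mA; rewrite -[X in measurable X]setTI; apply: measurable_contraction.
Qed.

(** Self-similarity gives [P(h < -e) <= P(h < -3 e)]: the preimage of [{h < -e}]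
    under each contraction lies in [{h < -3 e}].  Iterating, [P(h < -e)] is at most
    [P(h < -3^n e)], which tends to zero.  For [h] a barycentric coordinate this
    confines [P] to the triangle. *)
Lemma contraction_ge_null (h : R * R -> R) : measurable_fun setT h ->
  (forall i x, h x / 3 <= h (contraction i x)) ->
  P.-negligible [set x | h x < 0].
Proof.
move=> mh hc.
pose F e := [set x | h x < - e].
have mF e : measurable (F e).
  rewrite (_ : F e = h @^-1` `]-oo, (- e)[).
    by rewrite -[X in measurable X]setTI; apply: mh.
  by apply/seteqP; split => x /=; rewrite in_itv.
have F3 e : (P (F e) <= P (F (3 * e)%R))%E.
  have sub i : (P (contraction i @^-1` F e) <= P (F (3 * e)%R))%E.
    apply: le_measure; rewrite ?inE //; first exact: measurable_preimage_contraction.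
    by move=> x; rewrite /F /=; have := hc i x; lra.
  rewrite self_similarE //.
  have fin A : measurable A -> exists r, P A = r%:E.
    by move=> mA; exists (fine (P A)); rewrite fineK // fin_num_measure.
  have m i := measurable_preimage_contraction i (mF e).
  have := sub 0; have := sub 1; have := sub (inord 2).
  have [r ->] := fin _ (mF (3 * e)); have [r0 ->] := fin _ (m 0).
  have [r1 ->] := fin _ (m 1); have [r2 ->] := fin _ (m (inord 2)).
  by rewrite -!EFinD -EFinM !lee_fin; lra.
have F3n e n : (P (F e) <= P (F (3 ^+ n * e)%R))%E.
  elim: n => [|n IH]; first by rewrite expr0 mul1r.
  by rewrite exprS -mulrA; apply: le_trans IH _.
have F0 e : 0 < e -> P (F e) = 0%E.
  move=> e0; apply/eqP; rewrite eq_le measure_ge0 andbT.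
  pose G n := F (3 ^+ n * e)%R.
  have G0 : \bigcap_n G n = set0.
    apply/seteqP; split => // x /= Gx.
    have [n hn] : exists n : nat, - h x / e < 3 ^+ n.
      exists (Num.bound (- h x / e)).
      apply: (lt_le_trans (upper_nthrootP (leqnn _))).
      by apply: lerXn2r; rewrite ?nnegrE; lra.
    have := Gx n I; rewrite /G /F /=.
    by rewrite ltr_pdivrMr // in hn; lra.
  have : (P \o G) n @[n --> \oo] --> P (\bigcap_n G n).
    apply: nonincreasing_cvg_mu.
    - by rewrite ltey_eq fin_num_measure //; exact: mF.
    - by move=> n; exact: mF.
    - by rewrite G0.
    - move=> m n mn; apply/subsetPset => x; rewrite /G /F /= => hx.
      apply: (lt_le_trans hx); rewrite lerN2 ler_pM2r //.
      by apply: ler_weXn2l => //; lra.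
  rewrite G0 measure0 => cG; rewrite -(cvg_lim _ cG) //.
  apply: lime_ge; first by apply/cvg_ex; exists 0%E.
  by apply: nearW => n; exact: F3n.
rewrite (_ : [set x | _] = \bigcup_n F n.+1%:R^-1).
  apply: negligible_bigcup => n; apply/negligibleP => //; apply: F0.
  by rewrite invr_gt0 ltr0n.
apply/seteqP; split => x /=.
  move=> hx; exists (Num.bound (- (h x)^-1)) => //; rewrite /F /=.
  have hi : 0 < - (h x)^-1 by rewrite oppr_gt0 invr_lt0.
  rewrite ltrNr -[X in _ < X]invrK ltf_pV2 ?posrE ?ltr0n // ?invr_gt0 ?oppr_gt0 //.
  rewrite invrN; apply: lt_le_trans (archi_boundP (ltW hi)) _.
  by rewrite ler_nat.
case=> n _; rewrite /F /= => /lt_trans; apply.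
by rewrite oppr_lt0 invr_gt0 ltr0n.
Qed.

Lemma negligible_outside_triangle : P.-negligible (~` @triangle R).
Proof.
have null i : P.-negligible [set x | bary i x < 0].
  apply: contraction_ge_null; first exact: measurable_bary.
  by move=> j x; rewrite bary_contraction; case: (j == i) => /=; lra.
apply: negligibleS (negligibleU (null 0) (negligibleU (null 1) (null (inord 2)))).
move=> x /= /existsNP[i /negP]; rewrite -ltNge.
by elim/ord3_ind: i => ?; [left|right; left|right; right].
Qed.

Lemma ge0_integral_triangle A (F : R * R -> \bar R) : measurable A ->
    @triangle R `<=` A -> measurable_fun setT F -> (forall x, 0 <= F x)%E ->
  (\int[P]_(x in A) F x = \int[P]_(x in @triangle R) F x)%E.
Proof.
move=> mA TA mF F0.
rewrite (@ge0_negligible_integral _ _ _ _ _ (~` @triangle R)) //.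
- congr integral; apply/seteqP; split => x /=; last by split => //; apply: TA.
  by move=> [_ /contrapT].
- by apply: measurableC; exact: measurable_triangle.
- exact: measurable_funTS.
- by apply: measure_negligible negligible_outside_triangle;
    apply: measurableC; exact: measurable_triangle.
Qed.

(** The defining identity on sets extends to integrals because it says that [P] is
    a third of the sum of its three images; the preimage of the triangle under a
    contraction may be replaced by the triangle itself, being larger by a null
    set only. *)
Lemma ge0_integral_self_similar (F : R * R -> \bar R) :
    measurable_fun setT F -> (forall x, 0 <= F x)%E ->
  (\int[P]_(x in @triangle R) F x =
   (3^-1)%:E * (\int[P]_(x in @triangle R) F (contraction 0%R x)
   + \int[P]_(x in @triangle R) F (contraction 1%R x)
   + \int[P]_(x in @triangle R) F (contraction (inord 2) x)))%E.
Proof.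
move=> mF F0.
have mT := @measurable_triangle R.
have mFT : measurable_fun (@triangle R) F by exact: measurable_funTS.
have push i : exists2 Q : {measure set (R * R)%type -> \bar R},
    forall A, Q A = P (contraction i @^-1` A) &
    (\int[Q]_(x in @triangle R) F x =
     \int[P]_(x in @triangle R) F (contraction i x))%E.
  have m := @measurable_contraction R i.
  unshelve refine (ex_intro2 _ _
    (pushforward P (contraction i) : {measure set (R * R)%type -> \bar R}) _ _).
  - exact: m.
  - by [].
  transitivity (\int[P]_(x in contraction i @^-1` @triangle R) (F \o contraction i) x)%E.
    exact: ge0_integral_pushforward.
  apply: ge0_integral_triangle.
  - exact: measurable_preimage_contraction.
  - by move=> x; exact: contraction_triangle.
  - exact: measurableT_comp.
  - by move=> x; exact: F0.
have [Q0 Q0E I0] := push 0; have [Q1 Q1E I1] := push 1.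
have [Q2 Q2E I2] := push (inord 2).
have third_ge0 : 0 <= 3^-1 :> R by lra.
rewrite (eq_measure_integral
  (mscale (NngNum third_ge0) (measure_add (measure_add Q0 Q1) Q2))); last first.
  move=> A mA _; apply: etrans (self_similarE mA) _; rewrite -Q0E -Q1E -Q2E.
  rewrite /mscale; congr (_ * _)%E; apply/esym; apply: etrans (measure_addE _ _ _) _.
  by congr (_ + _)%E; exact: measure_addE.
by rewrite ge0_integral_mscale // !ge0_integral_measure_add // I0 I1 I2.
Qed.
End Support.

(** * Expectation of functions bounded on the triangle *)

Section Mean.
Variables (R : realType) (P : probability (R * R)%type R).
Hypothesis hP : self_similar P.
Implicit Types (x : R * R) (i : 'I_3) (t : 'I_3 -> R) (f g : R * R -> R).

(** Functions bounded on the triangle are integrable on it, and they are closed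
    under products, unlike integrable functions. *)
Definition admissible g : Prop :=
  measurable_fun setT g /\
  exists C, forall x, triangle x -> `|g x| <= C.

Definition mean g : R := \int[P]_(x in @triangle R) g x.

Lemma admissible_cst c : admissible (fun=> c).
Proof. by split => //; exists `|c|. Qed.

Lemma admissibleD f g : admissible f -> admissible g ->
  admissible (fun x => f x + g x).
Proof.
move=> [mf [C fC]] [mg [D gD]]; split; first exact: measurable_funD.
exists (C + D) => x Tx; apply: le_trans (ler_normD _ _) _.
by apply: lerD; [apply: fC | apply: gD].
Qed.

Lemma admissibleM f g : admissible f -> admissible g ->
  admissible (fun x => f x * g x).
Proof.
move=> [mf [C fC]] [mg [D gD]]; split; first exact: measurable_funM.
exists (C * D) => x Tx; rewrite normrM.
by apply: ler_pM => //; [apply: fC | apply: gD].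
Qed.

Lemma admissible_contraction i g : admissible g ->
  admissible (fun x => g (contraction i x)).
Proof.
move=> [mg [C gC]]; split; last by exists C => x /(contraction_triangle i) /gC.
by apply: measurableT_comp mg _; exact: measurable_contraction.
Qed.

Lemma admissible_affine t : admissible (affine t).
Proof.
split.
  apply: measurable_sum => i; apply: measurable_funM => //; exact: measurable_bary.
exists (\sum_i `|t i|) => x Tx; rewrite ler_norml; apply/andP; split.
  apply: affine_ge => // i; rewrite (bigD1 i) //=.
  have : 0 <= \sum_(j < 3 | j != i) `|t j| by apply: sumr_ge0.
  have := ler_norm (- t i); rewrite normrN; lra.
apply: affine_le => // i; rewrite (bigD1 i) //=.
have : 0 <= \sum_(j < 3 | j != i) `|t j| by apply: sumr_ge0.
have := ler_norm (t i); lra.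
Qed.

Lemma admissible_integrable g : admissible g ->
  P.-integrable (@triangle R) (EFin \o g).
Proof.
move=> [mg [C gC]]; apply: measurable_bounded_integrable.
- exact: measurable_triangle.
- by rewrite ltey_eq fin_num_measure //; exact: measurable_triangle.
- exact: measurable_funTS.
- exists C; split; first exact: num_real.
  by move=> D CD x Tx; apply: le_trans (gC _ Tx) (ltW CD).
Qed.

Lemma mean_le f g : admissible f -> admissible g ->
  (forall x, triangle x -> f x <= g x) -> mean f <= mean g.
Proof.
move=> af ag; apply: le_Rintegral; first exact: measurable_triangle.
- exact: admissible_integrable.
- exact: admissible_integrable.
Qed.

Lemma eq_mean f g : (forall x, triangle x -> f x = g x) -> mean f = mean g.
Proof. by move=> fg; apply: eq_Rintegral => x; rewrite inE => /fg. Qed.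

Lemma meanD f g : admissible f -> admissible g ->
  mean (fun x => f x + g x) = mean f + mean g.
Proof.
move=> af ag; apply: RintegralD; first exact: measurable_triangle.
- exact: admissible_integrable.
- exact: admissible_integrable.
Qed.

Lemma meanZ c g : admissible g -> mean (fun x => c * g x) = c * mean g.
Proof.
move=> ag; apply: RintegralZl; first exact: measurable_triangle.
exact: admissible_integrable.
Qed.

Lemma mean_cst c : mean (fun=> c) = c.
Proof.
have mT := @measurable_triangle R.
have PT : P (@triangle R) = 1%E.
  have PC : P (~` @triangle R) = 0%E.
    by apply: measure_negligible; [exact: measurableC|exact: negligible_outside_triangle].
  have := probability_setC P mT; rewrite PC.
  have /fineK <- : P (@triangle R) \is a fin_num by rewrite fin_num_measure.
  by move=> [] /eqP; rewrite eq_sym subr_eq0 => /eqP <-.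
rewrite /mean Rintegral_cst // -[RHS]mulr1; congr (_ * _).
by rewrite -[RHS]/(fine 1%E); congr (fine _); exact: PT.
Qed.

Lemma integral_mean g : admissible g -> (forall x, 0 <= g x) ->
  (\int[P]_x (g x)%:E)%E = (mean g)%:E.
Proof.
move=> ag g0; rewrite fineK; last first.
  by apply: integrable_fin_num; [exact: measurable_triangle|exact: admissible_integrable].
apply: ge0_integral_triangle => //.
by apply/measurable_EFinP; case: ag.
Qed.

(** Adding a constant that makes [g] nonnegative on the triangle reduces the claim
    to nonnegative functions. *)
Lemma mean_self_similar g : admissible g ->
  mean g = 3^-1 * (mean (fun x => g (contraction 0 x))
                   + mean (fun x => g (contraction 1 x))
                   + mean (fun x => g (contraction (inord 2) x))).
Proof.
move=> ag; have [mg [C gC]] := ag.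
(* The truncation makes the shifted function nonnegative off the triangle too. *)
pose G x := Num.max (g x + C) 0.
have GE x : triangle x -> G x = g x + C.
  by move=> /gC; rewrite ler_norml /G => /andP[? _]; apply/max_idPl; lra.
have aG : admissible (fun x => g x + C) by apply: admissibleD => //; exact: admissible_cst.
have EG (h : R * R -> R) f : admissible f -> (forall x, triangle x -> h x = f x + C) ->
    (\int[P]_(x in @triangle R) (h x)%:E)%E = (mean f + C)%:E.
  move=> af hE; rewrite -[in RHS](mean_cst C) -meanD //; last exact: admissible_cst.
  rewrite fineK; last first.
    apply: integrable_fin_num; first exact: measurable_triangle.
    by apply: (@admissible_integrable (fun x => f x + C)); apply: admissibleD => //; exact: admissible_cst.
  by apply: eq_integral => x; rewrite inE => /hE ->.
have mG : measurable_fun setT (EFin \o G).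
  by apply/measurable_EFinP; apply: measurable_maxr => //; apply: measurable_funD.
have G0 x : (0 <= (EFin \o G) x)%E by rewrite lee_fin /G le_max lexx orbT.
have EGi i : (\int[P]_(x in @triangle R) (EFin \o G) (contraction i x))%E =
    (mean (fun x => g (contraction i x)) + C)%:E.
  apply: EG; first exact: admissible_contraction.
  by move=> x /(contraction_triangle i); exact: GE.
have := ge0_integral_self_similar hP mG G0.
by rewrite !EGi (EG _ g) // -!EFinD -EFinM => -[]; lra.
Qed.

Lemma mean_self_similar_sum g : admissible g ->
  mean g = 3^-1 * \sum_i mean (fun x => g (contraction i x)).
Proof. by move=> ag; rewrite sum_ord3; exact: mean_self_similar. Qed.

End Mean.

(** * Quadratic inequalities for the masses of the cells *)

Section Algebra.
Variable R : realFieldType.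

(** The form [u^2 + u v + v^2] is dual to [a^2 - a b + b^2] in the sense that
    [3/4 (a u + b v)^2] is at most their product; the constant [1/3] then completes
    the square in [a u + b v]. *)
Lemma linear_le_quadratic (a b u v c : R) : a ^+ 2 - a * b + b ^+ 2 <= c ->
  a * u + b * v <= 1 / 3 + c * (u ^+ 2 + u * v + v ^+ 2).
Proof.
move=> abc; set q := u ^+ 2 + u * v + v ^+ 2.
have q0 : 0 <= q.
  rewrite (_ : q = (u + v / 2) ^+ 2 + 3 / 4 * v ^+ 2); last by rewrite /q; field.
  by rewrite addr_ge0 ?sqr_ge0 // mulr_ge0 ?sqr_ge0 //; lra.
have qc := ler_wpM2r q0 abc.
have eq : 1 / 3 + (a ^+ 2 - a * b + b ^+ 2) * q - (a * u + b * v) =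
    (a * (u / 2 + v) - b * (u + v / 2)) ^+ 2
    + 3 / 4 * (a * u + b * v - 2 / 3) ^+ 2.
  by rewrite /q; field.
have s1 := sqr_ge0 (a * (u / 2 + v) - b * (u + v / 2)).
have s2 := sqr_ge0 (a * u + b * v - 2 / 3).
lra.
Qed.

(** Coefficients [(a, b)] of the linear bound [a t_2 + b t_3] used for the first
    moment in a cell of mass [p].  With the break points [1/3] and [2/3] the
    inequality of [cell_bound_quadratic] holds at every corner of the nine resulting
    rectangles; the bound need not be continuous in [p]. *)
Definition cell_bound (p a b : R) : Prop :=
  [\/ p <= 1 / 3 /\ (a = 0 /\ b = p),
      1 / 3 <= p <= 2 / 3 /\ (a = 2 / 9 /\ b = 1 / 3) |
      2 / 3 <= p /\ (a = 1 - p /\ b = 1 - p)].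

Lemma cell_bound_exists (p u v e : R) : 0 <= p <= 1 -> e <= p * v ->
    e <= (1 - p) * (u + v) -> e <= (3 * v + 2 * u) / 9 ->
  exists a b, e <= a * u + b * v /\ cell_bound p a b.
Proof.
move=> p01 e1 e2 e3; have [h1|h1] := leP p (1 / 3).
  by exists 0, p; split; [lra|constructor 1].
have [h2|h2] := leP p (2 / 3).
  by exists (2 / 9), (1 / 3); split; [lra|constructor 2; split => //; apply/andP; split => //; exact: ltW].
by exists (1 - p), (1 - p); split; [lra|constructor 3; split => //; exact: ltW].
Qed.

(** On each of the nine rectangles the difference of the two sides is convex in each
    variable, so it is nonpositive as soon as it is at the corners.  Equality holds
    where [p] and [q] are both [0] or [1], that is, for unions of whole cells. *)
Lemma cell_bound_quadratic (p q a b c d : R) : 0 <= p <= 1 -> 0 <= q <= 1 ->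
    cell_bound p a b -> cell_bound q c d ->
  (2 * p + a + c) ^+ 2 - (2 * p + a + c) * (2 * q + b + d)
    + (2 * q + b + d) ^+ 2 <= 2 * ((p + q) * (3 - (p + q))).
Proof.
move=> /andP[p0 p1] /andP[q0 q1] [] [hp [-> ->]] [] [hq [-> ->]];
  move: hp hq => /= hp hq;
  rewrite ?expr2; try move/andP: hp => [hp hp']; try move/andP: hq => [hq hq']; nra.
Qed.

End Algebra.

(** * First moments of half-planes *)

Section Splitting.
Variables (R : realType) (P : probability (R * R)%type R).
Hypothesis hP : self_similar P.
Implicit Types (x : R * R) (i j k : 'I_3) (t : 'I_3 -> R) (f g : R * R -> R).
Local Notation mean := (mean P).

(** The estimates hold for every division of the mass into two parts, of which
    half-planes and their complements are the case needed. *)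
Definition fraction f : Prop :=
  measurable_fun setT f /\ forall x, 0 <= f x <= 1.

Lemma admissible_fraction f : fraction f -> admissible f.
Proof.
move=> [mf f01]; split => //; exists 1 => x _.
by rewrite ler_norml; have := f01 x; lra.
Qed.

Lemma fraction_contraction i f : fraction f -> fraction (fun x => f (contraction i x)).
Proof.
move=> [mf f01]; split => //; apply: measurableT_comp mf _.
exact: measurable_contraction.
Qed.

Lemma mean_lin a b f : admissible f -> mean (fun x => a * f x + b) = a * mean f + b.
Proof.
move=> af; rewrite meanD ?meanZ ?mean_cst //; last exact: admissible_cst.
by apply: admissibleM => //; exact: admissible_cst.
Qed.

Lemma mean_fraction f : fraction f -> 0 <= mean f <= 1.
Proof.
move=> ff; have [_ f01] := ff; have af := admissible_fraction ff.
apply/andP; split.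
  rewrite -[leLHS](mean_cst hP); apply: mean_le => //; first exact: admissible_cst.
  by move=> x _; case/andP: (f01 x).
rewrite -[leRHS](mean_cst hP); apply: mean_le => //; first exact: admissible_cst.
by move=> x _; case/andP: (f01 x).
Qed.

Lemma mean_affine t : \sum_i t i = 0 -> mean (affine t) = 0.
Proof.
move=> t0; have at_ := admissible_affine t.
have := mean_self_similar_sum hP at_.
under eq_bigr => i _.
  rewrite (_ : (fun x => _) = fun x => 3^-1 * affine t x + 2 / 3 * t i); last first.
    by apply/funext => x; rewrite affine_contraction mulrC.
  rewrite mean_lin //.
  over.
by rewrite big_split /= -!mulr_sumr t0 sumr_const card_ord; lra.
Qed.

(** One step of self-similarity for the first moment of [f] in the direction of
    [affine t]. *)
Lemma mean_fraction_affine t f : fraction f ->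
  mean (fun x => f x * affine t x) = 
   \sum_i (9^-1 * mean (fun x => f (contraction i x) * affine t x)
           + 2 / 9 * (t i * mean (fun x => f (contraction i x)))).
Proof.
move=> ff; have af := admissible_fraction ff; have at_ := admissible_affine t.
rewrite mean_self_similar_sum //; last exact: admissibleM.
rewrite mulr_sumr; apply: eq_bigr => i _.
have ac := admissible_contraction i af.
rewrite (_ : (fun x => _) = fun x => 3^-1 * (f (contraction i x) * affine t x)
    + 2 / 3 * t i * f (contraction i x)); last first.
  by apply/funext => x; rewrite affine_contraction; field.
have am := admissibleM ac at_.
rewrite meanD ?meanZ //; first by field.
- by apply: admissibleM => //; exact: admissible_cst.
- by apply: admissibleM => //; exact: admissible_cst.
Qed.

Section Ordered.
Variables (t : 'I_3 -> R) (i j k : 'I_3).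
Hypothesis sumE : forall F : 'I_3 -> R, \sum_l F l = F i + F j + F k.
Hypotheses (tij : t i <= t j) (tjk : t j <= t k) (t0 : \sum_l t l = 0).

Lemma ends_bounds l : t i <= t l <= t k.
Proof.
have : \sum_m (l == m)%:R = 1 :> R.
  by rewrite (bigD1 l) //= eqxx big1 ?addr0 // => m; rewrite eq_sym => /negPf ->.
rewrite sumE => one; have [->|li] := eqVneq l i; first by rewrite lexx (le_trans tij tjk).
have [->|lj] := eqVneq l j; first by rewrite tij tjk.
have [->|lk] := eqVneq l k; first by rewrite lexx (le_trans tij tjk).
by move: one; rewrite (negPf li) (negPf lj) (negPf lk) /=; lra.
Qed.

Let ti : t i = - (t j + t k).
Proof. by move: t0; rewrite sumE; lra. Qed.

Let affine_bounds x : triangle x -> t i <= affine t x <= t k.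
Proof.
move=> Tx; apply/andP; split.
- by apply: affine_ge => // l; case/andP: (ends_bounds l).
- by apply: affine_le => // l; case/andP: (ends_bounds l).
Qed.

Lemma mean_le_top g : fraction g -> mean (fun x => g x * affine t x) <= mean g * t k.
Proof.
move=> fg; have [_ g01] := fg; have ag := admissible_fraction fg.
have at_ := admissible_affine t.
rewrite mulrC -meanZ //; apply: mean_le.
- exact: admissibleM.
- by apply: admissibleM => //; exact: admissible_cst.
by move=> x /affine_bounds; have := g01 x; nra.
Qed.

(** Since [affine t] has mean zero, the first moment of [g] is minus that of [1 - g],
    and [affine t] is at least [t i = - (t j + t k)]. *)
Lemma mean_le_bottom g : fraction g ->
  mean (fun x => g x * affine t x) <= (1 - mean g) * (t j + t k).
Proof.
move=> fg; have [_ g01] := fg; have ag := admissible_fraction fg.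
have at_ := admissible_affine t.
have -> : (1 - mean g) * (t j + t k) = mean (fun x => affine t x + (t i * g x + - t i)).
  have ac : admissible (fun x => t i * g x + - t i).
    by apply: admissibleD; [apply: admissibleM => //|]; exact: admissible_cst.
  by rewrite meanD ?mean_lin // mean_affine // ti; ring.
apply: mean_le.
- exact: admissibleM.
- apply: admissibleD => //; apply: admissibleD; last exact: admissible_cst.
  by apply: admissibleM => //; exact: admissible_cst.
by move=> x /affine_bounds; have := g01 x; nra.
Qed.

(** This bound does not involve the mass of [g]: in the decomposition along the cells, the cell [i] contributes
    nothing positive, the cell [k] at most the mean of [affine t + 2 t k], and in
    the cell [j] the function is at most its maximum [t k + 2 t j]. *)
Lemma mean_le_cst g : fraction g ->
  mean (fun x => g x * affine t x) <= (3 * t k + 2 * t j) / 9.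
Proof.
move=> fg; rewrite mean_fraction_affine // sumE.
have at_ := admissible_affine t.
have bd l a b c : (forall x y, 0 <= y <= 1 -> triangle x ->
     y * affine t x + 2 * t l * y <= a * affine t x + b) -> b <= c ->
  9^-1 * mean (fun x => g (contraction l x) * affine t x)
           + 2 / 9 * (t l * mean (fun x => g (contraction l x))) <= 9^-1 * c.
  move=> h bc.
  have fl := fraction_contraction l fg; have al := admissible_fraction fl.
  have am := admissibleM al at_.
  have : mean (fun x => g (contraction l x) * affine t x + 2 * t l * g (contraction l x))
      <= mean (fun x => a * affine t x + b).
    apply: mean_le.
    - by apply: admissibleD => //; apply: admissibleM => //; exact: admissible_cst.
    - by apply: admissibleD; [apply: admissibleM => //|]; exact: admissible_cst.
    by move=> x Tx; apply: h => //; case: fl.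
  rewrite meanD ?meanZ // ?mean_lin // ?mean_affine //.
    by lra.
  by apply: admissibleM => //; exact: admissible_cst.
(* Each cell is bounded by the mean of [a * affine t + b], that is, by [b]. *)
have hi := bd i 0 0 0; have hj := bd j 0 (t k + 2 * t j) (t k + 2 * t j).
have hk := bd k 1 (2 * t k) (2 * t k).
suff [h1 h2 h3] : [/\ forall x y, 0 <= y <= 1 -> triangle x ->
     y * affine t x + 2 * t i * y <= 0 * affine t x + 0,
     forall x y, 0 <= y <= 1 -> triangle x ->
     y * affine t x + 2 * t j * y <= 0 * affine t x + (t k + 2 * t j) &
     forall x y, 0 <= y <= 1 -> triangle x ->
     y * affine t x + 2 * t k * y <= 1 * affine t x + 2 * t k].
  have := hi h1 (lexx _); have := hj h2 (lexx _); have := hk h3 (lexx _); lra.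
have ti_ := ti; have tij_ := tij; have tjk_ := tjk.
split=> x y /andP[y0 y1] /affine_bounds/andP[l1 l2].
- have : y * (affine t x + 2 * t i) <= 0 by rewrite mulr_ge0_le0 //; lra.
  lra.
- have : y * (affine t x + 2 * t j) <= y * (t k + 2 * t j) by rewrite ler_wpM2l //; lra.
  have : y * (t k + 2 * t j) <= 1 * (t k + 2 * t j) by rewrite ler_wpM2r //; lra.
  lra.
- have : y * (affine t x + 2 * t k) <= 1 * (affine t x + 2 * t k).
    by rewrite ler_wpM2r //; lra.
  lra.
Qed.

(** The main estimate, for a function that vanishes on the lowest cell.  The right
    side is the arithmetic-geometric form of a variance bound
    [E(f L)^2 <= 4/27 p (1 - p) (t_1^2 + t_2^2 + t_3^2)]. *)
Lemma mean_fraction_affine_le f : fraction f ->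
    (forall x, triangle x -> f (contraction i x) = 0) ->
  2 * mean (fun x => f x * affine t x) <=
    2 / 27 + 2 * (mean f * (1 - mean f)) * \sum_l t l ^+ 2.
Proof.
move=> ff fi; have af := admissible_fraction ff; have at_ := admissible_affine t.
have := mean_fraction_affine t ff; rewrite sumE.
have := mean_self_similar_sum hP af; rewrite sumE.
have -> : mean (fun x => f (contraction i x)) = 0.
  by rewrite (@eq_mean _ P _ (fun=> 0)) ?mean_cst.
have -> : mean (fun x => f (contraction i x) * affine t x) = 0.
  by rewrite (@eq_mean _ P _ (fun=> 0)) ?mean_cst // => x /fi ->; rewrite mul0r.
have fj := fraction_contraction j ff; have fk := fraction_contraction k ff.
have [a [b [ejb cj]]] := cell_bound_exists (mean_fraction fj) (mean_le_top fj)
  (mean_le_bottom fj) (mean_le_cst fj).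
have [c [d [ekb ck]]] := cell_bound_exists (mean_fraction fk) (mean_le_top fk)
  (mean_le_bottom fk) (mean_le_cst fk).
have := linear_le_quadratic (t j) (t k)
  (cell_bound_quadratic (mean_fraction fj) (mean_fraction fk) cj ck).
move: ejb ekb; set ej := mean _; set ek := mean (fun x => f (contraction k x) * _).
set pj := mean (fun x => f (contraction j x)).
set pk := mean (fun x => f (contraction k x)).
move=> ejb ekb key -> ->; rewrite sumE ti; lra.
Qed.

End Ordered.

Definition halfplane t (theta : R) x : R := (theta <= affine t x)%R%:R.

Lemma fraction_halfplane t theta : fraction (halfplane t theta).
Proof.
have [mt _] := admissible_affine t.
split; last by move=> x; rewrite /halfplane; case: (theta <= _); rewrite ?lexx ?ler01.
rewrite (_ : halfplane t theta = \1_(affine t @^-1` `[theta, +oo[)).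
  by apply: measurable_indic; rewrite -[X in measurable X]setTI; apply: mt.
apply/funext => x; rewrite indicE /halfplane; congr (nat_of_bool _)%:R.
by apply/idP/idP; rewrite inE /= in_itv /= andbT.
Qed.

(** If the half-plane met the lowest cell [i] and its complement met the highest
    cell [k], then [(t i + 2 t k) / 3 < theta <= (t k + 2 t i) / 3], against
    [t i <= t k].  So the half-plane misses the cell [i] or its complement misses the
    cell [k]; the complement is handled by changing the sign of [t]. *)
Lemma mean_halfplane_le t theta (f := halfplane t theta) : \sum_l t l = 0 ->
  2 * mean (fun x => f x * affine t x) <=
    2 / 27 + 2 * (mean f * (1 - mean f)) * \sum_l t l ^+ 2.
Proof.
move=> t0.
have [i [j [k [tij tjk sumE]]]] := sort3 t.
have ff : fraction f by exact: fraction_halfplane.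
have at_ := admissible_affine t.
have af := admissible_fraction ff.
(* [(t k + 2 * t i) / 3] is the maximum of [affine t] on the lowest cell. *)
have [low|high] := ltP ((t k + 2 * t i) / 3) theta.
  apply: (mean_fraction_affine_le sumE tij tjk t0 ff) => x Tx.
  have tk : affine t x <= t k.
    apply: affine_le => // l; case/andP: (ends_bounds sumE tij tjk l) => //.
  by rewrite /f /halfplane affine_contraction leNgt (_ : _ < theta) //; lra.
pose g x := 1 - f x.
have fg : fraction g.
  case: ff => mf f01; split; first exact: measurable_funB.
  by move=> x; rewrite /g; have := f01 x; lra.
have sumE' (F : 'I_3 -> R) : \sum_l F l = F k + F j + F i by rewrite sumE; lra.
have t0' : \sum_l (\- t) l = 0 by rewrite sumrN t0 oppr0.
have tkj : (\- t) k <= (\- t) j by rewrite lerN2.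
have tji : (\- t) j <= (\- t) i by rewrite lerN2.
have gk x : triangle x -> g (contraction k x) = 0.
  move=> Tx.
  have tx : t i <= affine t x.
    apply: affine_ge => // l; case/andP: (ends_bounds sumE tij tjk l) => //.
  by rewrite /g /f /halfplane affine_contraction (_ : theta <= _) ?subrr //; lra.
have := mean_fraction_affine_le sumE' tkj tji t0' fg gk.
have -> : mean g = 1 - mean f.
  rewrite -[X in _ = X - _](mean_cst hP 1) -mulN1r -meanZ // -meanD //.
  - by apply: eq_mean => x _; rewrite mulN1r.
  - exact: admissible_cst.
  - by apply: admissibleM => //; exact: admissible_cst.
have -> : mean (fun x => g x * affine (\- t) x) = mean (fun x => f x * affine t x).
  rewrite -[RHS]addr0 -(mean_affine t0') -meanD.
  - by apply: eq_mean => x _; rewrite affine_opp /g; ring.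
  - exact: admissibleM.
  - exact: admissible_affine.
have -> : \sum_l (\- t) l ^+ 2 = \sum_l t l ^+ 2.
  by apply: eq_bigr => l _; rewrite sqrrN.
by rewrite subKr [mean f * _]mulrC.
Qed.
End Splitting.

(** * Squared distances and the cost of two points *)

Section Distances.
Variable R : realType.
Implicit Types (x a b d : R * R).

Definition sqdist x a : R := (x.1 - a.1) ^+ 2 + (x.2 - a.2) ^+ 2.

Lemma sqr_enorm x a : enorm (x - a) ^+ 2 = sqdist x a.
Proof. by rewrite /enorm sqr_sqrtr // addr_ge0 ?sqr_ge0. Qed.

Lemma sqdist_ge0 x a : 0 <= sqdist x a.
Proof. by rewrite addr_ge0 ?sqr_ge0. Qed.

(** Values at the vertices of the linear form [x |-> d . (x - centroid)]. *)
Definition height d (i : 'I_3) : R :=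
  d.1 * ((vertex i).1 - centroid.1) + d.2 * ((vertex i).2 - centroid.2).

Lemma sum_height d : \sum_i height d i = 0.
Proof. by rewrite sum_ord3 /height vertex2 /=; field. Qed.

Lemma sum_sqr_height d : \sum_i height d i ^+ 2 = (d.1 ^+ 2 + d.2 ^+ 2) / 2.
Proof.
have s3 := sqr_sqrt3 R; rewrite sum_ord3 /height vertex2 /=.
by field: s3.
Qed.

Lemma affine_height d x :
  affine (height d) x =
  d.1 * (x.1 - centroid.1) + d.2 * (x.2 - centroid.2).
Proof.
have s0 := sqrt3_neq0 R.
by rewrite /affine sum_ord3 /height vertex2 bary2 /bary /=; field.
Qed.

Lemma admissible_sqdist a : admissible (sqdist ^~ a).
Proof.
have H d c : admissible (fun x => affine (height d) x + c).
  by apply: admissibleD; [exact: admissible_affine|exact: admissible_cst].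
have := admissibleD
  (admissibleM (H (1, 0) (centroid.1 - a.1)) (H (1, 0) (centroid.1 - a.1)))
  (admissibleM (H (0, 1) (centroid.2 - a.2)) (H (0, 1) (centroid.2 - a.2))).
congr admissible; apply/funext => x; rewrite !affine_height /sqdist /=; ring.
Qed.

Lemma sqdist_centroid a x : sqdist x a =
  sqdist x centroid
  + 2 * affine (height (centroid - a)) x + sqdist centroid a.
Proof. by rewrite affine_height /sqdist /=; ring. Qed.

(** The cross term is a linear form centred at the centroid, hence has mean zero: a
    cell behaves like a copy of [P] at scale [1/3] around the image of the
    centroid. *)
Lemma sqdist_contraction i x a : sqdist (contraction i x) a =
  sqdist x centroid / 9
  + 2 / 3 * affine (height (contraction i centroid - a)) x
  + sqdist (contraction i centroid) a.
Proof. by rewrite affine_height /contraction /sqdist /=; rewrite /GRing.scale /=; field. Qed.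

End Distances.
Arguments sqdist {R} x a.

Section Moments.
Variables (R : realType) (P : probability (R * R)%type R).
Hypothesis hP : self_similar P.
Local Notation mean := (mean P).
Local Notation c := (@centroid R).

Lemma mean_sqdist_contraction i a : mean (fun x => sqdist (contraction i x) a) =
  mean (sqdist ^~ c) / 9 + sqdist (contraction i c) a.
Proof.
have as_ := admissible_sqdist c.
have at_ := admissible_affine (height (contraction i c - a)).
rewrite (@eq_mean _ P _ (fun x => 9^-1 * sqdist x c
  + (2 / 3 * affine (height (contraction i c - a)) x + sqdist (contraction i c) a))).
  rewrite meanD ?meanZ ?mean_lin // ?mean_affine ?sum_height //; first by field.
  - by apply: admissibleM => //; exact: admissible_cst.
  - by apply: admissibleD; [apply: admissibleM => //|]; exact: admissible_cst.
by move=> x _; rewrite sqdist_contraction; field.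
Qed.

Lemma variance : mean (sqdist ^~ c) = 1 / 6.
Proof.
have := mean_self_similar_sum hP (admissible_sqdist c).
under eq_bigr => i _ do rewrite mean_sqdist_contraction.
rewrite big_split /= sumr_const card_ord.
have -> : \sum_i sqdist (contraction i c) c = 4 / 9.
  rewrite sum_ord3 /sqdist /contraction vertex2 /vertex /= /GRing.scale /=.
  have s3 := sqr_sqrt3 R.
  by field: s3.
by lra.
Qed.

(** With [p] the mass of the points closer to [a], the cost is [1/6 - 2 E(f L)] plus
    [p |a-c|^2 + (1-p) |b-c|^2]; the latter exceeds [p (1-p) |a-b|^2] by the square
    [|p (a-c) + (1-p) (b-c)|^2]. *)
Lemma mean_min_ge a b :
  5 / 54 <= mean (fun x => Num.min (sqdist x a) (sqdist x b)).
Proof.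
pose d := a - b; pose t := height d.
pose u := sqdist c a; pose v := sqdist c b.
pose f := halfplane t ((u - v) / 2).
have t0 : \sum_i t i = 0 := sum_height d.
have key := @mean_halfplane_le _ P hP t ((u - v) / 2) t0.
have ff : fraction f := fraction_halfplane _ _.
have af := admissible_fraction ff.
have at_ := admissible_affine t.
have aft := admissibleM af at_.
have ab := admissible_affine (height (c - b)).
have as_ := admissible_sqdist c.
have minE x : Num.min (sqdist x a) (sqdist x b) =
    sqdist x c + ((2 * affine (height (c - b)) x + v)
      + (- 2 * (f x * affine t x) + (u - v) * f x)).
  have : sqdist x a - sqdist x b = u - v - 2 * affine t x.
    by rewrite /u /v /t /d !affine_height /sqdist /=; ring.
  rewrite (sqdist_centroid b x) -/v /f /halfplane.
  by case: lerP => h1 h2; [rewrite min_l|rewrite min_r]; rewrite /=; lra.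
rewrite (eq_mean P (fun x _ => minE x)).
have am c1 g : admissible g -> admissible (fun x : R * R => c1 * g x).
  by move=> ag; apply: admissibleM => //; exact: admissible_cst.
have a1 : admissible (fun x => 2 * affine (height (c - b)) x + v).
  by apply: admissibleD; [exact: am|exact: admissible_cst].
have a2 : admissible (fun x => - 2 * (f x * affine t x) + (u - v) * f x).
  by apply: admissibleD; exact: am.
rewrite meanD // ?variance; last exact: admissibleD.
rewrite meanD // mean_lin // mean_affine ?sum_height // meanD ?meanZ //; try exact: am.
move: key; rewrite -/f sum_sqr_height.
set p := mean f; set m := mean _ => key.
have sq : p * u + (1 - p) * v - p * (1 - p) * (d.1 ^+ 2 + d.2 ^+ 2)
   = (p * (c.1 - a.1) + (1 - p) * (c.1 - b.1)) ^+ 2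
   + (p * (c.2 - a.2) + (1 - p) * (c.2 - b.2)) ^+ 2.
  by rewrite /u /v /d /sqdist /=; ring.
have : 0 <= p * u + (1 - p) * v - p * (1 - p) * (d.1 ^+ 2 + d.2 ^+ 2).
  by rewrite sq addr_ge0 ?sqr_ge0.
lra.
Qed.

Lemma admissible_min (f g : R * R -> R) : admissible f -> admissible g ->
  admissible (fun x => Num.min (f x) (g x)).
Proof.
move=> [mf [C fC]] [mg [D gD]]; split; first exact: measurable_minr.
exists (C + D) => x Tx; have := fC x Tx; have := gD x Tx.
have := normr_ge0 (f x); have := normr_ge0 (g x).
by case: (leP (f x) (g x)) => _; lra.
Qed.

(** Assigning the two lower cells to the lower point and the top cell to the upper
    one costs [1/54] per cell for its own spread; each lower cell adds [1/9], since
    the lower point is the midpoint of the centroids of these two cells. *)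
Lemma mean_min_le :
  mean (fun x => Num.min (sqdist x (1 / 2, 7 / (6 * Num.sqrt 3)))
                         (sqdist x (1 / 2, 1 / (6 * Num.sqrt 3)))) <= 5 / 54.
Proof.
set a := (1 / 2, 7 / _); set b := (1 / 2, 1 / _).
have amin : admissible (fun x => Num.min (sqdist x a) (sqdist x b)).
  by apply: admissible_min; exact: admissible_sqdist.
rewrite mean_self_similar //.
have le i e : (forall x, Num.min (sqdist x a) (sqdist x b) <= sqdist x e) ->
    mean (fun x => Num.min (sqdist (contraction i x) a) (sqdist (contraction i x) b))
      <= 1 / 54 + sqdist (contraction i c) e.
  move=> h; apply: le_trans (_ : mean (fun x => sqdist (contraction i x) e) <= _).
    apply: mean_le => //.
    - exact: (admissible_contraction i amin).
    - exact: admissible_contraction (admissible_sqdist e).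
  by rewrite mean_sqdist_contraction variance; lra.
have le_a x : Num.min (sqdist x a) (sqdist x b) <= sqdist x a by rewrite ge_min lexx.
have le_b x : Num.min (sqdist x a) (sqdist x b) <= sqdist x b by rewrite ge_min lexx orbT.
have := le 0 b le_b; have := le 1 b le_b; have := le (inord 2) a le_a.
have s0 := sqrt3_neq0 R; have s3 := sqr_sqrt3 R.
have -> : sqdist (contraction 0 c) b = 1 / 9.
  rewrite /sqdist /contraction /vertex /= /GRing.scale /=; by field: s3.
have -> : sqdist (contraction 1 c) b = 1 / 9.
  rewrite /sqdist /contraction /vertex /= /GRing.scale /=; by field: s3.
have -> : sqdist (contraction (inord 2) c) a = 0.
  rewrite /sqdist /contraction vertex2 /= /GRing.scale /=; by field: s3.
lra.
Qed.

End Moments.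

(** * Optimality *)

Lemma bigmin_fset2 (R : realType) (F : R * R -> \bar R) (a b : R * R) :
  \big[Order.min/+oo%E]_(e <- [fset a; b]%fset) F e = Order.min (F a) (F b).
Proof.
apply/eqP; rewrite eq_le; apply/andP; split.
  by rewrite le_min !ge_bigmin_seq // !inE eqxx ?orbT.
rewrite big_seq; apply: le_bigmin => [|e]; first exact: leey.
by rewrite !inE => /orP[] /eqP ->; rewrite ge_min lexx ?orbT.
Qed.

(** The two points may coincide, so that sets with one element need no separate
    treatment. *)
Lemma fset_le2 (K : choiceType) (A : {fset K}) :
  A != fset0 -> (#|` A| <= 2)%N -> exists a b, A = [fset a; b]%fset.
Proof.
move=> /fset0Pn[a aA]; rewrite -(fsetD1K aA) cardfsU1 !inE eqxx /= add1n ltnS => le1.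
case: (posnP (#|` A `\ a|)%fset) => [/cardfs0_eq ->|gt0].
  by exists a, a; rewrite fsetU0 fsetUid.
have /cardfs1P[b ->] : (#|` A `\ a| == 1)%fset by rewrite eqn_leq le1.
by exists a, b.
Qed.

Lemma distortion_fset2 (R : realType) (P : probability (R * R)%type R)
    (hP : self_similar P) (a b : R * R) :
  distortion P [fset a; b]%fset =
    (mean P (fun x => Num.min (sqdist x a) (sqdist x b)))%:E.
Proof.
rewrite -integral_mean //.
- by apply: eq_integral => x _; rewrite bigmin_fset2 !sqr_enorm EFin_min.
- by apply: admissible_min; exact: admissible_sqdist.
- by move=> x; rewrite le_min !sqdist_ge0.
Qed.

Theorem proposition3p1 (R : realType) (P : probability (R * R)%type R)
    (hP : self_similar P) :
  optimal_n_means P 2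
    [fset ((1 / 2, 7 / (6 * Num.sqrt 3)) : R * R);
          ((1 / 2, 1 / (6 * Num.sqrt 3)) : R * R)]%fset
  /\ quantization_error P 2 = (5 / 54)%:E.
Proof.
set alpha := (X in optimal_n_means _ _ X).
have alpha0 : alpha != fset0 by rewrite -cardfs_eq0 cardfs2.
have alpha2 : (#|` alpha| <= 2)%N by rewrite cardfs2; case: (_ == _).
have dist_ge A : A != fset0 -> (#|` A| <= 2)%N -> ((5 / 54)%:E <= distortion P A)%E.
  move=> A0 A2; have [a [b ->]] := fset_le2 A0 A2.
  by rewrite distortion_fset2 // lee_fin; exact: mean_min_ge.
have dist_alpha : distortion P alpha = (5 / 54)%:E.
  apply/eqP; rewrite eq_le dist_ge // andbT distortion_fset2 // lee_fin.
  exact: mean_min_le.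
have V2 : quantization_error P 2 = (5 / 54)%:E.
  apply/eqP; rewrite eq_le; apply/andP; split.
    by rewrite -dist_alpha; apply: ereal_inf_lbound; exists alpha.
  by apply: le_ereal_inf_tmp => _ [A [A0 A2] <-]; exact: dist_ge.
by split => //; split => //; rewrite dist_alpha.
Qed.
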